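(* For every integer $t$ there is a constant $n_t$ such that for every finite graph $G$ of twin-width at most $t$ and every non-empty set $A \subseteq V(G)$ we have $|N_G(A)| \le n_t |A|$.
   Context: Graphs are finite, undirected and simple. For $A \subseteq V(G)$ and $v \in V(G)$, $N_A(v) = \{u \in A : uv \in E(G)\}$, and $N_G(A) = \{N_A(v) : v \in V(G)\}$ is the set of distinct neighborhoods traced on $A$. Twin-width: a trigraph is a triple $(V,E,R)$ with $E,R$ disjoint sets of (black) edges and red edges on $V$; a graph $(V,E)$ is the trigraph $(V,E,\emptyset)$. Contracting two vertices $u,v$ of a trigraph yields a new vertex $w$ replacing $u,v$ (all other adjacencies unchanged) such that for each other vertex $x$: $wx$ is a black edge if $ux,vx$ are both black edges; $wx$ is not an edge at all if neither $ux$ nor $vx$ is a black edge (and, in the original definition, neither is red, i.e. $ux,vx$ both non-edges); and $wx$ is a red edge otherwise. A $d$-trigraph is one whose red graph has maximum degree at most $d$. The twin-width of $G$ is the least $d$ such that $G$ can be contracted to a single vertex by a sequence of contractions in which every intermediate trigraph is a $d$-trigraph. *)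

(* Defs.v *)
From mathcomp Require Import all_boot all_order all_algebra.

Set Implicit Arguments.
Unset Strict Implicit.
Unset Printing Implicit Defensive.

Record sgraph := SGraph {
  svertex :> finType;
  edge : rel svertex;
  edge_sym : symmetric edge;
  edge_irr : irreflexive edge }.

Definition nbh_in (G : sgraph) (A : {set G}) (v : G) : {set G} :=
  [set u in A | edge u v].

Definition nbh_traces (G : sgraph) (A : {set G}) : {set {set G}} :=
  [set nbh_in A v | v : G].

Record trigraph := Trigraph {
  tvertex :> finType;
  black : rel tvertex;
  red : rel tvertex;
  black_sym : symmetric black;
  black_irr : irreflexive black;
  red_sym : symmetric red;
  red_irr : irreflexive red;
  black_red_disj : forall x y, ~~ (black x y && red x y) }.

Section TrigraphOfGraph.
Variable G : sgraph.

Fact nored_sym : symmetric (fun _ _ : G => false). Proof. by []. Qed.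
Fact nored_irr : irreflexive (fun _ : G => fun _ : G => false).
Proof. by []. Qed.
Fact nored_disj (x y : G) : ~~ (edge x y && false).
Proof. by rewrite andbF. Qed.

Definition trigraph_of_graph : trigraph :=
  Trigraph (@edge_sym G) (@edge_irr G) nored_sym nored_irr nored_disj.

End TrigraphOfGraph.

Section Contraction.
Variables (G : trigraph) (u v : G).

(* [None] is the new vertex w; [Some x] is an old vertex x other than u, v. *)
Definition contract_vertex : finType :=
  option {x : G | (x != u) && (x != v)}.

Definition nonadj (x y : G) : bool := ~~ black x y && ~~ red x y.

Definition new_black (x : G) : bool := black u x && black v x.

Definition new_red (x : G) : bool :=
  ~~ new_black x && ~~ (nonadj u x && nonadj v x).

Definition contract_black : rel contract_vertex := fun a b =>
  match a, b with
  | Some x, Some y => black (val x) (val y)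
  | None, Some x | Some x, None => new_black (val x)
  | None, None => false
  end.

Definition contract_red : rel contract_vertex := fun a b =>
  match a, b with
  | Some x, Some y => red (val x) (val y)
  | None, Some x | Some x, None => new_red (val x)
  | None, None => false
  end.

Fact contract_black_sym : symmetric contract_black.
Proof. by move=> [x|] [y|] //=; exact: black_sym. Qed.
Fact contract_black_irr : irreflexive contract_black.
Proof. by move=> [x|] //=; exact: black_irr. Qed.
Fact contract_red_sym : symmetric contract_red.
Proof. by move=> [x|] [y|] //=; exact: red_sym. Qed.
Fact contract_red_irr : irreflexive contract_red.
Proof. by move=> [x|] //=; exact: red_irr. Qed.
Fact contract_disj a b : ~~ (contract_black a b && contract_red a b).
Proof.
case: a b => [x|] [y|] //=; first exact: black_red_disj.
  by rewrite /new_red; case: new_black.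
by rewrite /new_red; case: new_black.
Qed.

Definition contract : trigraph :=
  Trigraph contract_black_sym contract_black_irr
           contract_red_sym contract_red_irr contract_disj.

Lemma card_contract : u != v -> #|contract|.+1 = #|G|.
Proof.
move=> uv; rewrite card_option card_sig /=.
have -> : #|[pred x | (x != u) && (x != v)]| = #|~: [set u; v]|.
  by apply: eq_card => x; rewrite !inE negb_or.
by rewrite -(cardsC [set u; v]) cards2 uv.
Qed.

End Contraction.

Definition d_trigraph (d : nat) (G : trigraph) : bool :=
  [forall x : G, #|[set y : G | red x y]| <= d].

(* The base case also accepts the empty trigraph, which only makes
   [twin_width] total: the empty graph gets twin-width 0. *)
Inductive contractible (d : nat) : trigraph -> Prop :=
| contractible_end (G : trigraph) :
    d_trigraph d G -> #|G| <= 1 -> contractible d G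
| contractible_step (G : trigraph) (u v : G) :
    d_trigraph d G -> u != v -> contractible d (contract u v) ->
    contractible d G.

(* Decision procedure for [contractible], with fuel [n]. *)
Fixpoint contractibleb (d n : nat) (G : trigraph) : bool :=
  d_trigraph d G &&
  ((#|G| <= 1) ||
   (if n is n'.+1 then
      [exists u : G, exists v : G,
         (u != v) && contractibleb d n' (contract u v)]
    else false)).

Lemma contractibleP (d : nat) (G : trigraph) :
  reflect (contractible d G) (contractibleb d #|G| G).
Proof.
apply: (iffP idP).
  move: {1}#|G| => n; elim: n G => [|n IHn] G /= /andP[dG].
    by rewrite orbF; exact: contractible_end.
  case/orP => [G1|]; first exact: contractible_end.
  case/existsP => u /existsP[v /andP[uv /IHn]].
  exact: contractible_step.
elim=> {G} [G dG G1|G u v dG uv _ IH].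
  by case: {1}#|G| => [|n] /=; rewrite dG G1.
rewrite -(card_contract uv) /= dG /=; apply/orP; right.
by apply/existsP; exists u; apply/existsP; exists v; rewrite uv.
Qed.

Lemma d_trigraphW d d' (G : trigraph) :
  d <= d' -> d_trigraph d G -> d_trigraph d' G.
Proof. by move=> le /forallP dG; apply/forallP => x; apply: leq_trans le. Qed.

Lemma contractibleW d d' (G : trigraph) :
  d <= d' -> contractible d G -> contractible d' G.
Proof.
move=> le; elim=> {G} [G dG G1|G u v dG uv _ IH].
  exact: contractible_end (d_trigraphW le dG) G1.
exact: contractible_step (d_trigraphW le dG) uv IH.
Qed.

Lemma contractible_card (G : trigraph) : contractible #|G| G.
Proof.
have dT (d : nat) (H : trigraph) : #|H| <= d -> d_trigraph d H.
  by move=> le; apply/forallP => x; apply: leq_trans (max_card _) le.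
suff main d (H : trigraph) : #|H| <= d -> contractible d H by exact: main.
move: {2}#|H| (leqnn #|H|) => n; elim: n H => [|n IHn] H Hn Hd.
  by apply: contractible_end; [exact: dT | exact: leq_trans Hn _].
have [H1|] := leqP #|H| 1; first by apply: contractible_end => //; exact: dT.
case/card_gt1P => u [v [_ _ uv]].
have cE := card_contract uv.
apply: (contractible_step (dT _ _ Hd) uv); apply: IHn.
  by rewrite -ltnS cE.
by apply: leq_trans Hd; rewrite -cE.
Qed.

Fact twin_width_subproof (G : sgraph) :
  exists d, contractibleb d #|G| (trigraph_of_graph G).
Proof.
by exists #|G|; apply/(contractibleP _ (trigraph_of_graph G));
   exact: contractible_card (trigraph_of_graph G).
Qed.

Definition twin_width (G : sgraph) : nat := ex_minn (twin_width_subproof G).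

Lemma twin_widthP (G : sgraph) :
  contractible (twin_width G) (trigraph_of_graph G) /\
  forall d, contractible d (trigraph_of_graph G) -> twin_width G <= d.
Proof.
rewrite /twin_width; case: ex_minnP => m Hm mP; split.
  exact/(contractibleP m (trigraph_of_graph G)).
by move=> d /(contractibleP d (trigraph_of_graph G)); exact: mP.
Qed.

(* Main.v *)
(** Run a contraction sequence until it first merges two vertices [x], [y] of
    [A].  Just before, every part contains at most one vertex of [A], and the
    vertices of one part have the same trace on [A] outside the at most [d + 1]
    parts that are equal or red to it; so a part contains at most [2 ^ (d + 1)]
    vertices with pairwise distinct traces.  After the merge, [x] and [y] lie in
    one part and are told apart only by vertices of that part or of its at most
    [d] red neighbours, hence by boundedly many vertices with distinct traces.
    Deleting [x] from [A] identifies two traces only if one of them separates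
    [x] from [y], so it loses boundedly many traces; induct on [A]. *)
Require Import Defs.
From mathcomp Require Import all_boot all_order all_algebra.

Set Implicit Arguments.
Unset Strict Implicit.
Unset Printing Implicit Defensive.

Lemma leq_card_fibers (T U : finType) (f : T -> U) (D : {set T}) (S : {set U})
    (k : nat) :
  {in D, forall x, f x \in S} ->
  (forall h, #|[set x in D | f x == h]| <= k) ->
  #|D| <= #|S| * k.
Proof.
move=> fDS fib; rewrite -sum1_card (partition_big f (mem S)) //=.
rewrite -sum_nat_const; apply: leq_sum => h _.
apply: leq_trans (fib h); rewrite -sum1_card.
by rewrite (eq_bigl (mem [set x in D | f x == h])) // => x; rewrite !inE.
Qed.

(* [f] sends every vertex of [G] to the vertex of [H] it was contracted into. *)
Definition contracts_to {G : sgraph} {H : trigraph} (f : G -> H) : Prop :=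
  forall x y, f x != f y -> ~~ red (f x) (f y) -> edge x y = black (f x) (f y).

Lemma contracts_to_id (G : sgraph) :
  @contracts_to G (trigraph_of_graph G) id.
Proof. by []. Qed.

(** [insub] is the quotient map of the contraction: it sends [u] and [v] to the new vertex [None]
    and fixes all others. *)
Lemma contracts_to_contract (G : sgraph) (H : trigraph) (f : G -> H) (u v : H) :
  contracts_to f -> @contracts_to G (contract u v) (fun x => insub (f x)).
Proof.
move=> fH.
have merged z w : ~~ ((f z != u) && (f z != v)) ->
    (f w != u) && (f w != v) -> ~~ new_red u v (f w) ->
    edge z w = new_black u v (f w).
  rewrite negb_and !negbK => fz /andP[wu wv].
  (* Not being red to the new vertex means black to both [u] and [v] or adjacent to neither, so it
     does not matter which of the two [f z] is. *)
  rewrite /new_red negb_and !negbK => hw.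
  have fzw : f z != f w by case/orP: fz => /eqP->; rewrite eq_sym.
  case: (boolP (new_black u v (f w))) hw => [/andP[bu bv] _ | nb] /=.
    have bzw : black (f z) (f w) by case/orP: fz => /eqP->.
    rewrite fH ?bzw //.
    by apply: contraL (black_red_disj (f z) (f w)); rewrite bzw negbK.
  case/andP=> /andP[bu ru] /andP[bv rv].
  rewrite fH //; last by case/orP: fz => /eqP->.
  by apply/negbTE; case/orP: fz => /eqP->.
move=> x y.
case: (insubP {z : H | (z != u) && (z != v)} (f x)) => [a Pa ea|Nx];
  case: (insubP {z : H | (z != u) && (z != v)} (f y)) => [b Pb eb|Ny] //=.
- move=> ab; rewrite ea eb => nr; apply: fH => //.
  by apply: contra ab => /eqP e; apply/eqP; congr Some; apply: val_inj; rewrite /= ea eb.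
- by move=> _; rewrite ea edge_sym; apply: merged.
- by move=> _; rewrite eb; apply: merged.
Qed.

Section Traces.
Context {G : sgraph}.
Implicit Types A B : {set G}.

Definition separators B (x y : G) : {set G} :=
  [set b in B | edge x b != edge y b].

Lemma card_part (H : trigraph) (f : G -> H) (d : nat) A B (h : H) :
  contracts_to f -> d_trigraph d H ->
  {in A &, injective f} -> {in B &, injective (nbh_in A)} ->
  #|[set b in B | f b == h]| <= 2 ^ d.+1.
Proof.
move=> fH /forallP/(_ h) dh injf injB.
pose A' := [set a in A | f a \in h |: [set k | red h k]].
have cA' : #|A'| <= d.+1.
  have sA' : {subset A' <= A} by move=> a; rewrite inE => /andP[].
  rewrite -(card_in_imset (sub_in2 sA' injf)).
  apply: leq_trans (_ : #|h |: [set k | red h k]| <= _).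
    by apply/subset_leq_card/subsetP => _ /imsetP[a aA' ->]; move: aA'; rewrite inE => /andP[].
  by rewrite cardsU1 -add1n leq_add // leq_b1.
apply: leq_trans (_ : 2 ^ #|A'| <= _); last by rewrite leq_exp2l.
rewrite -card_powerset -(@card_in_imset _ _ (nbh_in A')).
  apply/subset_leq_card/subsetP => _ /imsetP[b _ ->].
  by rewrite powersetE; apply/subsetP => a; rewrite inE => /andP[].
(* Outside [A'], adjacency to a vertex of the part [h] depends on [h] only, so equal traces on [A']
   are equal traces on [A]. *)
move=> b c; rewrite !inE => /andP[bB /eqP fb] /andP[cB /eqP fc] bc.
apply: injB => //; apply/setP => a; rewrite !inE.
case aA: (a \in A) => //=.
have [aA'|] := boolP (a \in A').
  by move/setP/(_ a): bc; rewrite [a \in nbh_in _ b]inE [a \in nbh_in _ c]inE aA'.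
rewrite !inE aA /= negb_or => /andP[ah nr].
by rewrite !fH ?fb ?fc // red_sym.
Qed.

(** The factor [d.+2] counts [u], [v] and the at most [d] red neighbours of the merged vertex;
    [2 ^ d.+1] is the bound of [card_part]. *)
Definition sep_bound (d : nat) : nat := d.+2 * 2 ^ d.+1.

(** Separators are located by the red edges after the contraction, but counted part by part before
    it, where [f] is still injective on [A]. *)
Lemma card_separators_merged (H : trigraph) (f : G -> H) (d : nat) A B
    (u v : H) (x y : G) :
  contracts_to f -> d_trigraph d H -> d_trigraph d (contract u v) ->
  {in A &, injective f} -> {in B &, injective (nbh_in A)} ->
  f x \in [set u; v] -> f y \in [set u; v] ->
  #|separators B x y| <= sep_bound d.
Proof.
move=> fH dH /forallP/(_ None) dC injf injB fx fy.
have gH := @contracts_to_contract G H f u v fH.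
set g := (fun z => insub (f z)) in gH.
have merged z : f z \in [set u; v] -> g z = None.
  by rewrite !inE => fz; rewrite /g insubF // -negb_or fz.
set R := [set k | _] in dC.
(* This map reads the vertices of the contraction back in [H]. The default [u] stands for the new
   vertex, and no old vertex is mapped to it. *)
have injval : injective (odflt u \o omap val : contract u v -> H).
  move=> [a|] [b|] //= e; first by rewrite (val_inj e).
    by move: (valP a); rewrite /= e eqxx.
  by move: (valP b); rewrite /= -e eqxx.
pose S := v |: (odflt u \o omap val) @: (None |: R).
have cS : #|S| <= d.+2.
  rewrite cardsU1 card_imset // cardsU1 -[d.+2]add1n -[d.+1]add1n.
  by rewrite !leq_add // leq_b1.
apply: leq_trans (_ : #|S| * 2 ^ d.+1 <= _); last by rewrite leq_mul2r cS orbT.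
apply: (leq_card_fibers (f := f)) => [b|h].
  rewrite inE => /andP[_ sep].
  have [->|bv] := eqVneq (f b) v; first exact: setU11.
  have [->|bu] := eqVneq (f b) u.
    by rewrite setU1r //; apply/imsetP; exists None; rewrite ?setU11.
  have fbP : (f b != u) && (f b != v) by rewrite bu.
  rewrite setU1r //; apply/imsetP; exists (Some (Sub (f b) fbP)) => //=.
  rewrite setU1r // inE; apply: contraR sep => nr.
  have gb : g b = Some (Sub (f b) fbP) by rewrite /g insubT.
  by rewrite !gH ?gb ?(merged x) ?(merged y).
apply: leq_trans (_ : #|[set b in B | f b == h]| <= _); last exact: card_part injB.
by apply/subset_leq_card/subsetP => b; rewrite !inE => /andP[/andP[-> _] ->].
Qed.

Lemma exists_few_separators (H : trigraph) (f : G -> H) (d : nat) A B :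
  contractible d H -> contracts_to f ->
  {in A &, injective f} -> {in B &, injective (nbh_in A)} -> 1 < #|A| ->
  exists x y, [/\ x \in A, y \in A, x != y & #|separators B x y| <= sep_bound d].
Proof.
move=> cH fH injf injB A1; elim: cH f fH injf => {H} [H _ H1|H u v dH uv cC IH] f fH injf.
  (* At most one part is left, yet [f] is injective on the at least two vertices of [A]. *)
  suff: 1 < 1 by []; apply: leq_trans A1 _; apply: leq_trans _ H1.
  by rewrite -(card_in_imset injf) max_card.
have dC : d_trigraph d (contract u v) by case: cC.
pose g x : contract u v := insub (f x).
case: (boolP [exists x in A, exists y in A, (x != y) && (g x == g y)]); last first.
  move=> inj; apply: (IH g); first exact: contracts_to_contract.
  move=> x y xA yA gxy; apply/eqP; apply: contraR inj => xy.
  by apply/existsP; exists x; rewrite xA; apply/existsP; exists y; rewrite yA xy; apply/eqP.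
case/existsP=> x /andP[xA /existsP[y /and3P[yA xy /eqP gxy]]].
have fxy : f x != f y by apply: contra xy => /eqP /injf ->.
exists x, y; split=> //.
(* Distinct parts with the same image under the contraction must both go to [None]. *)
have [fx fy] : f x \in [set u; v] /\ f y \in [set u; v].
  move: gxy; rewrite /g !inE.
  case: insubP => [a _ ea|]; case: insubP => [b _ eb|] //.
    by case=> ab; rewrite -ea -eb ab eqxx in fxy.
  by rewrite !negb_and !negbK.
exact: (@card_separators_merged H f d A B u v).
Qed.

Lemma trace_representatives A :
  exists2 B : {set G}, {in B &, injective (nbh_in A)} & nbh_traces A = nbh_in A @: B.
Proof.
(* The [pick] depends only on the trace of [v], and it never fails because [v] itself qualifies. *)
pose r v := odflt v [pick w | nbh_in A w == nbh_in A v].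
have rP v : nbh_in A (r v) = nbh_in A v.
  by rewrite /r; case: pickP => [w /eqP|].
have r_eq v w : nbh_in A v = nbh_in A w -> r v = r w.
  rewrite /r => ->; case: pickP => // /(_ w).
  by rewrite eqxx.
exists [set r v | v : G].
  by move=> _ _ /imsetP[v _ ->] /imsetP[w _ ->]; rewrite !rP; apply: r_eq.
apply/setP => S; apply/imsetP/imsetP => [[v _ ->]|[v _ ->]]; last by exists v.
by exists (r v); rewrite ?rP ?imset_f.
Qed.

Lemma card_traces_setD1 A B (x y : G) :
  nbh_traces A = nbh_in A @: B -> x \in A -> y \in A -> x != y ->
  #|nbh_traces A| <= #|nbh_traces (A :\ x)| + #|separators B x y|.
Proof.
move=> AB xA yA xy.
(* Without a separation of [x] and [y], the trace on [A :\ x] determines the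
   trace on [A]. *)
pose ext (S : {set G}) := if y \in S then x |: S else S.
apply: leq_trans (_ : #|ext @: nbh_traces (A :\ x) :|: nbh_in A @: separators B x y| <= _).
  apply/subset_leq_card/subsetP => S; rewrite AB => /imsetP[b bB ->].
  rewrite inE; case: (boolP (b \in separators B x y)) => [sb|].
    by rewrite [X in _ || X]imset_f ?orbT.
  rewrite inE bB negbK /= => /eqP exy; apply/orP; left.
  apply/imsetP; exists (nbh_in (A :\ x) b); first exact: imset_f.
  apply/setP => a; rewrite /ext !inE yA eq_sym xy /=.
  case: ifP => yb; rewrite !inE; have [->|ax] := eqVneq a x => //=.
    by rewrite xA exy yb.
  by rewrite xA exy yb.
by apply: leq_trans (leq_card_setU _ _) _; rewrite leq_add ?leq_imset_card.
Qed.

Lemma card_traces_le_exp A : #|nbh_traces A| <= 2 ^ #|A|.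
Proof.
rewrite -card_powerset; apply/subset_leq_card/subsetP => _ /imsetP[v _ ->].
by rewrite powersetE; apply/subsetP => a; rewrite inE => /andP[].
Qed.

Lemma card_traces_contractible (d : nat) A :
  contractible d (trigraph_of_graph G) -> A != set0 ->
  #|nbh_traces A| <= sep_bound d * #|A|.
Proof.
move=> cG; move: {2}#|A| (erefl #|A|) => n; elim: n A => [|n IHn] A cA.
  by rewrite -card_gt0 cA.
move=> _; case: n IHn cA => [|n] IHn cA.
  (* A singleton has no pair to merge, but it has at most two traces. *)
  apply: leq_trans (card_traces_le_exp A) _.
  by rewrite cA muln1 -[2 ^ 1]muln1 leq_mul // expn_gt0.
have [B injB AB] := trace_representatives A.
have [||x [y [xA yA xy sep]]] :=
  exists_few_separators cG (@contracts_to_id G) _ injB.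
- by move=> ? ?.
- by rewrite cA.
have cAx : #|A :\ x| = n.+1.
  by apply/eqP; rewrite -eqSS -cA (cardsD1 x A) xA.
apply: leq_trans (card_traces_setD1 AB xA yA xy) _.
by rewrite cA mulnS addnC leq_add // -cAx IHn // -card_gt0 cAx.
Qed.

End Traces.

Theorem theorem1 (t : int) :
  exists n_t : nat, forall (G : sgraph) (A : {set G}),
    (Posz (twin_width G) <= t)%R -> A != set0 ->
    #|nbh_traces A| <= n_t * #|A|.
Proof.
(* For negative [t] no graph satisfies the bound on the twin-width. *)
case: t => d; last by exists 0.
exists (sep_bound d) => G A tw; apply: card_traces_contractible.
exact: contractibleW tw (twin_widthP G).1.
Qed.
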